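(* Let $\lambda^*,\mu>0$ with $\rho=\lambda^*/\mu<1$. Let $\bar\pi^k$ be the stationary distribution of the number of customers in the $E_k/M/1$ queue with mean inter-arrival time $1/\lambda^*$ and mean service time $1/\mu$, and let $\bar\pi^D$ be the stationary distribution of the number of customers in the $D/M/1$ queue with the same mean inter-arrival and mean service times. Then: (i) $\bar\pi^D\preceq_{st}\bar\pi^{k+1}\preceq_{st}\bar\pi^k$ for all $k=1,2,\ldots$; (ii) $L_k\downarrow L_D$, $W_k\downarrow W_D$ and $V_k\downarrow V_D$ as $k\to\infty$, monotonically, where $L_k,W_k,V_k$ (respectively $L_D,W_D,V_D$) denote the mean number of customers in the system, the expected sojourn time of a customer, and the variance of the number of customers in the system, under the stationary distribution of the $E_k/M/1$ queue (respectively the $D/M/1$ queue).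
   Context: $E_k/M/1$: single-server queue with i.i.d. Erlang inter-arrival times consisting of $k$ exponential phases each of rate $k\lambda^*$ and exponential service times with rate $\mu$. $D/M/1$: single-server queue with deterministic inter-arrival times $1/\lambda^*$ and exponential service times with rate $\mu$. Stationary distributions of the number of customers are the time-stationary (not arrival-embedded) ones; for $D/M/1$ it is $\bar\pi^D_0=1-\rho$, $\bar\pi^D_m=(1-\sigma)\rho\sigma^{m-1}$ for $m>0$, with $\sigma$ the unique root smaller than $1$ of $\sigma=e^{-(1-\sigma)/\rho}$. For probability distributions on $\{0,1,\ldots\}$, $p\preceq_{st}p'$ means $\sum_{m\ge M}p_m\le\sum_{m\ge M}p'_m$ for all $M=0,1,\ldots$. *)

(* Defs.v *)
(* Laws on {0, 1, ...} are given by their mass functions [nat -> R]. *)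
From Stdlib Require Import Reals Arith.
From Coquelicot Require Import Coquelicot.
Open Scope R_scope.

Definition st_le (p p' : nat -> R) : Prop :=
  forall M : nat,
    Series (fun m => p (M + m)%nat) <= Series (fun m => p' (M + m)%nat).

Definition is_mean (p : nat -> R) (l : R) : Prop :=
  is_series (fun m => INR m * p m) l.

Definition is_variance (p : nat -> R) (v : R) : Prop :=
  exists l : R, is_mean p l /\ is_series (fun m => (INR m - l) ^ 2 * p m) v.

(* The law [a] is that of the number of customers found by an arriving
   customer.  Finding m customers, under FIFO he stays for m + 1 successive
   exponential times of mean 1 / mu (the residual service is exponential by
   lack of memory). *)
Definition is_mean_sojourn (mu : R) (a : nat -> R) (w : R) : Prop :=
  is_series (fun m => INR (S m) * / mu * a m) w.

(* Sequences indexed by k = 1, 2, ...; the entry of index 0 is ignored. *)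
Definition decreases_to (u : nat -> R) (l : R) : Prop :=
  (forall k : nat, (1 <= k)%nat -> u (S k) <= u k) /\ is_lim_seq u l.

(** * E_k/M/1 *)

(* Markov chain on the states (m, j): m customers present and j < k phases
   completed in the current inter-arrival time.  Completion of the last phase
   moves (m, k - 1) to (m + 1, 0). *)

Definition EkM1_phase_inflow (lam : R) (k : nat) (p : nat -> nat -> R)
    (m j : nat) : R :=
  match j, m with
  | S j', _ => INR k * lam * p m j'
  | O, S m' => INR k * lam * p m' (k - 1)%nat
  | O, O => 0
  end.

Definition EkM1_exit_rate (lam mu : R) (k m : nat) : R :=
  INR k * lam + match m with O => 0 | S _ => mu end.

Definition EkM1_customers (k : nat) (p : nat -> nat -> R) (m : nat) : R :=
  sum_n (fun j => p m j) (k - 1).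

(* The values of [p m j] for j >= k are irrelevant. *)
Definition EkM1_stationary (lam mu : R) (k : nat) (p : nat -> nat -> R) : Prop :=
  (forall m j : nat, (j < k)%nat -> 0 <= p m j) /\
  is_series (EkM1_customers k p) 1 /\
  (forall m j : nat, (j < k)%nat ->
     p m j * EkM1_exit_rate lam mu k m =
     EkM1_phase_inflow lam k p m j + mu * p (S m) j).

(* Arrivals finding m customers occur at rate [INR k * lam * p m (k - 1)];
   this is their proportion among all arrivals. *)
Definition EkM1_at_arrival (k : nat) (p : nat -> nat -> R) (m : nat) : R :=
  p m (k - 1)%nat / Series (fun n => p n (k - 1)%nat).

(** * D/M/1 *)

Definition poisson (x : R) (l : nat) : R := exp (- x) * x ^ l / INR (fact l).

(* Probability that, starting from i customers, m remain after a time t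
   without arrivals. *)
Definition service_kernel (mu t : R) (i m : nat) : R :=
  match m, i with
  | O, O => 1
  | O, S i' => 1 - sum_n (poisson (mu * t)) i'
  | S _, _ => if (m <=? i)%nat then poisson (mu * t) (i - m) else 0
  end.

(* Law of the number of customers at time t after an arrival who found a number
   of customers of law [a]. *)
Definition DM1_after (mu : R) (a : nat -> R) (t : R) (m : nat) : R :=
  Series (fun i => a i * service_kernel mu t (S i) m).

(* [a] is a stationary law of the chain of the numbers of customers found by
   successive arrivals. *)
Definition DM1_arrival_stationary (lam mu : R) (a : nat -> R) : Prop :=
  (forall m : nat, 0 <= a m) /\
  is_series a 1 /\
  (forall m : nat, DM1_after mu a (/ lam) m = a m).

(* In time-stationary regime the time elapsed since the last arrival is uniform
   on the interval from 0 to 1 / lam. *)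
Definition DM1_customers (lam mu : R) (a : nat -> R) (m : nat) : R :=
  lam * RInt (fun t => DM1_after mu a t m) 0 (/ lam).

(* Main.v *)
(* In both queues the number of customers has a law of the form
   1 - rho, rho (1 - s), rho (1 - s) s, rho (1 - s) s^2, ... which is
   stochastically increasing in s and has explicit moments, so everything reduces
   to sigma_k decreasing to sigma_D.

   For E_k/M/1 the balance equations away from the empty levels have the solution
   z^(m k + j), with z + ... + z^k = k rho.  The difference d between a stationary
   law and a multiple of it, chosen so that d(0, k - 1) = 0, vanishes: if T m is the
   sum of |d(m, j)| over j, the triangle inequality makes
   mu T (m + 1) - k lam |d(m, k - 1)| nondecreasing in m; it tends to 0 and its
   first value is mu T 1.
   For D/M/1 the analogous l^1 estimate is [backward_recursion_zero].

   With w = (1 - sigma_k) / rho the root equation reads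
   sigma_k (1 + w / k)^k = 1; since (1 + w / k)^k increases with k, sigma_k
   decreases, and its limit s satisfies s = exp (- (1 - s) / rho), that is, it is
   sigma_D. *)
Require Import Defs.
From Stdlib Require Import Reals Lra Lia.
From Coquelicot Require Import Coquelicot.
Open Scope R_scope.

(** * Finite sums and real series *)

Lemma sum_n_S (u : nat -> R) (n : nat) : sum_n u (S n) = sum_n u n + u (S n) :> R.
Proof. now rewrite sum_Sn. Qed.

Lemma sum_n_0 (u : nat -> R) : sum_n u 0 = u 0%nat :> R.
Proof. apply sum_O. Qed.

Lemma sum_n_nonneg (u : nat -> R) (n : nat) :
  (forall i, (i <= n)%nat -> 0 <= u i) -> 0 <= sum_n u n.
Proof.
  induction n as [|n IH]; intros H.
  - rewrite sum_n_0; apply H; lia.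
  - rewrite sum_n_S; specialize (H (S n) (le_n _)) as H1.
    enough (0 <= sum_n u n) by lra; apply IH; intros i Hi; apply H; lia.
Qed.

Lemma sum_n_le (u v : nat -> R) (n : nat) :
  (forall i, (i <= n)%nat -> u i <= v i) -> sum_n u n <= sum_n v n.
Proof.
  induction n as [|n IH]; intros H.
  - rewrite !sum_n_0; apply H; lia.
  - rewrite !sum_n_S; apply Rplus_le_compat; [|apply H; lia].
    apply IH; intros i Hi; apply H; lia.
Qed.

Lemma sum_n_scal (c : R) (u : nat -> R) (n : nat) :
  sum_n (fun i => c * u i) n = c * sum_n u n :> R.
Proof. exact (sum_n_mult_l (K := R_Ring) c u n). Qed.

Lemma sum_n_add (u v : nat -> R) (n : nat) :
  sum_n (fun i => u i + v i) n = sum_n u n + sum_n v n :> R.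
Proof. exact (sum_n_plus (G := R_AbelianMonoid) u v n). Qed.

Lemma term_le_sum_n (u : nat -> R) (n j : nat) :
  (forall i, (i <= n)%nat -> 0 <= u i) -> (j <= n)%nat -> u j <= sum_n u n.
Proof.
  induction n as [|n IH]; intros H Hj.
  - replace j with 0%nat by lia; rewrite sum_n_0; lra.
  - rewrite sum_n_S; destruct (Nat.eq_dec j (S n)) as [->|Hne].
    + enough (0 <= sum_n u n) by lra; apply sum_n_nonneg; auto.
    + enough (u j <= sum_n u n) by (specialize (H (S n) (le_n _)); lra).
      apply IH; [auto | lia].
Qed.

Lemma is_series_of_lim (u : nat -> R) (l : R) :
  is_lim_seq (sum_n u) l -> is_series u l.
Proof. auto. Qed.

Lemma is_series_ext_R (u v : nat -> R) (l : R) :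
  (forall n, u n = v n) -> is_series u l -> is_series v l.
Proof. intros H; apply is_series_ext, H. Qed.

Lemma is_series_scal_R (c : R) (u : nat -> R) (l : R) :
  is_series u l -> is_series (fun n => c * u n) (c * l).
Proof. exact (is_series_scal_l (V := R_NormedModule) c u l). Qed.

Lemma is_series_cons (u : nat -> R) (l : R) :
  is_series (fun n => u (S n)) l -> is_series u (u 0%nat + l).
Proof.
  intros H; apply is_series_decr_1.
  change (is_series (fun n => u (S n)) (u 0%nat + l + - u 0%nat)).
  now replace (u 0%nat + l + - u 0%nat) with l by ring.
Qed.

Lemma partial_sum_le (u : nat -> R) (l : R) (n : nat) :
  (forall i, 0 <= u i) -> is_series u l -> sum_n u n <= l.
Proof.
  intros Hu Hl; apply (is_lim_seq_incr_compare (sum_n u)); [exact Hl|].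
  intros k; rewrite sum_n_S; specialize (Hu (S k)); lra.
Qed.

Lemma is_series_telescope (f : nat -> R) :
  is_lim_seq f 0 -> is_series (fun n => f n - f (S n)) (f 0%nat).
Proof.
  intros Hf; apply is_series_of_lim.
  apply is_lim_seq_ext with (fun n => f 0%nat - f (S n)).
  - induction n as [|n IH]; [now rewrite sum_n_0|].
    rewrite sum_n_S, <- IH; ring.
  - replace (f 0%nat) with (f 0%nat - 0) at 1 by ring.
    apply is_lim_seq_minus'; [apply is_lim_seq_const|].
    now apply -> is_lim_seq_incr_1.
Qed.

(** * Geometric series *)

(** These are the terms of the second derivative of the power series with all coefficients 1, which
    has radius of convergence 1; the terms of a convergent series tend to 0. *)
Lemma geom_square_lim (x : R) : 0 <= x < 1 ->
  is_lim_seq (fun n => INR (S n) * INR (S (S n)) * x ^ n) 0.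
Proof.
  intros Hx.
  set (one_seq := fun _ : nat => 1).
  assert (Hr : CV_radius one_seq = 1).
  { replace 1 with (/ 1) by field.
    apply CV_radius_finite_DAlembert; unfold one_seq; try (intros; lra).
    apply is_lim_seq_ext with (fun _ => 1); [|apply is_lim_seq_const].
    intros _; rewrite Rdiv_diag by lra; now rewrite Rabs_R1. }
  apply ex_series_lim_0.
  assert (H : ex_pseries (PS_derive (PS_derive one_seq)) x).
  { apply CV_radius_inside; rewrite !CV_radius_derive, Hr.
    simpl; rewrite Rabs_pos_eq; lra. }
  apply ex_pseries_R in H.
  revert H; apply ex_series_ext; intros n.
  unfold PS_derive, one_seq; now rewrite Rmult_1_r.
Qed.

Lemma quadratic_geom_lim (a b c x : R) : 0 <= x < 1 ->
  is_lim_seq (fun n => (a + b * INR n + c * INR n ^ 2) * x ^ n) 0.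
Proof.
  intros Hx; pose proof (geom_square_lim x Hx) as H.
  set (m := Rabs a + Rabs b + Rabs c).
  apply is_lim_seq_abs_0.
  apply is_lim_seq_le_le
    with (fun _ => 0) (fun n => m * (INR (S n) * INR (S (S n)) * x ^ n)).
  - intros n; split; [apply Rabs_pos|].
    pose proof (pow_le x n (proj1 Hx)) as Hp.
    pose proof (pos_INR n) as Hn.
    rewrite Rabs_mult, (Rabs_pos_eq (x ^ n)) by exact Hp.
    rewrite <- Rmult_assoc; apply Rmult_le_compat_r; [exact Hp|].
    rewrite !S_INR.
    apply Rle_trans with (Rabs a + Rabs b * INR n + Rabs c * INR n ^ 2).
    + eapply Rle_trans; [apply Rabs_triang|].
      apply Rplus_le_compat; [eapply Rle_trans; [apply Rabs_triang|]|].
      * rewrite Rabs_mult, (Rabs_pos_eq (INR n)) by exact Hn; lra.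
      * rewrite Rabs_mult, (Rabs_pos_eq (INR n ^ 2)) by nra; lra.
    + unfold m.
      pose proof (Rabs_pos a); pose proof (Rabs_pos b); pose proof (Rabs_pos c).
      assert (0 <= Rabs a * INR n) by now apply Rmult_le_pos.
      assert (0 <= Rabs b * INR n) by now apply Rmult_le_pos.
      assert (0 <= Rabs c * INR n) by now apply Rmult_le_pos.
      assert (0 <= Rabs a * INR n * INR n) by now apply Rmult_le_pos.
      assert (0 <= Rabs b * INR n * INR n) by now apply Rmult_le_pos.
      nra.
  - apply is_lim_seq_const.
  - replace 0 with (m * 0) by ring.
    exact (is_lim_seq_scal_l _ m 0 H).
Qed.

(** The common source of the mean, the variance and the mean sojourn time: each has a quadratic
    polynomial in n times a geometric term as its summand. *)
Lemma quadratic_geom_series (a b c x : R) : 0 <= x < 1 ->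
  is_series (fun n => (a + b * INR n + c * INR n ^ 2) * x ^ n)
    (a / (1 - x) + b * x / (1 - x) ^ 2 + c * x * (1 + x) / (1 - x) ^ 3).
Proof.
  intros Hx.
  (* The coefficients of the primitive f solve f n - f (n + 1) = u n. *)
  set (c' := c / (1 - x)).
  set (b' := (b + 2 * x * c') / (1 - x)).
  set (a' := (a + x * b' + x * c') / (1 - x)).
  set (f := fun n => (a' + b' * INR n + c' * INR n ^ 2) * x ^ n).
  replace (a / (1 - x) + b * x / (1 - x) ^ 2 + c * x * (1 + x) / (1 - x) ^ 3)
    with (f 0%nat) by (unfold f, a', b', c'; simpl; field; lra).
  apply is_series_ext_R with (fun n => f n - f (S n)).
  - intros n; unfold f; rewrite S_INR; simpl (x ^ S n).
    unfold a', b', c'; field; lra.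
  - apply is_series_telescope, quadratic_geom_lim, Hx.
Qed.

Lemma geom_series (c x : R) : 0 <= x < 1 ->
  is_series (fun n => c * x ^ n) (c / (1 - x)).
Proof.
  intros Hx; unfold Rdiv; apply is_series_scal_R, is_series_geom.
  rewrite Rabs_pos_eq; lra.
Qed.

(** * The common form of the stationary laws *)

Definition queue_law (rho s : R) (m : nat) : R :=
  match m with O => 1 - rho | S n => rho * (1 - s) * s ^ n end.

(** The second moment rho (1 + s) / (1 - s)^2 minus the squared mean. For rho and s in (0, 1) the
    factors 1 + s - rho and 1 / (1 - s)^2 are positive and increase with s. *)
Definition queue_variance (rho s : R) : R := rho * (1 + s - rho) / (1 - s) ^ 2.

Section QueueLaw.

Variables (rho s : R).
Hypothesis (Hs : 0 <= s < 1).

Lemma queue_law_tail_0 : is_series (queue_law rho s) 1.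
Proof.
  replace 1 with (queue_law rho s 0 + rho * (1 - s) / (1 - s))
    by (simpl; field; lra).
  now apply is_series_cons, geom_series.
Qed.

Lemma queue_law_tail_S (M : nat) :
  is_series (fun m => queue_law rho s (S M + m)) (rho * s ^ M).
Proof.
  replace (rho * s ^ M) with (rho * (1 - s) * s ^ M / (1 - s)) by (field; lra).
  eapply is_series_ext_R; [|now apply geom_series].
  intros n; simpl; rewrite pow_add; ring.
Qed.

Lemma queue_law_mean : is_mean (queue_law rho s) (rho / (1 - s)).
Proof.
  unfold is_mean.
  pose proof (quadratic_geom_series
    (rho * (1 - s)) (rho * (1 - s)) 0 s Hs) as H.
  replace (rho / (1 - s)) with (INR 0 * queue_law rho s 0
    + (rho * (1 - s) / (1 - s) + rho * (1 - s) * s / (1 - s) ^ 2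
       + 0 * s * (1 + s) / (1 - s) ^ 3)) by (simpl; field; lra).
  apply (is_series_cons (fun m => INR m * queue_law rho s m)).
  eapply is_series_ext_R; [|exact H].
  intros n; rewrite S_INR; simpl; ring.
Qed.

Lemma queue_law_variance : is_variance (queue_law rho s) (queue_variance rho s).
Proof.
  exists (rho / (1 - s)); split; [exact queue_law_mean|].
  set (l := rho / (1 - s)); set (c := rho * (1 - s)).
  (* State 0 is split off; for m = n + 1 the square expands as (1 - l)^2 + 2 (1 - l) n + n^2. *)
  pose proof (quadratic_geom_series
    (c * (1 - l) ^ 2) (c * 2 * (1 - l)) c s Hs) as H.
  replace (queue_variance rho s) with ((INR 0 - l) ^ 2 * queue_law rho s 0
    + (c * (1 - l) ^ 2 / (1 - s) + c * 2 * (1 - l) * s / (1 - s) ^ 2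
       + c * s * (1 + s) / (1 - s) ^ 3))
    by (unfold queue_variance, c, l; simpl; field; lra).
  apply (is_series_cons (fun m => (INR m - l) ^ 2 * queue_law rho s m)).
  eapply is_series_ext_R; [|exact H].
  intros n; rewrite S_INR; unfold c; simpl; ring.
Qed.

End QueueLaw.

Lemma queue_law_st_le (rho s s' : R) : 0 < rho < 1 -> 0 <= s <= s' -> s' < 1 ->
  st_le (queue_law rho s) (queue_law rho s').
Proof.
  intros Hrho Hs Hs' [|M].
  - change (Series (queue_law rho s) <= Series (queue_law rho s')).
    rewrite (is_series_unique _ _ (queue_law_tail_0 rho s ltac:(lra))).
    rewrite (is_series_unique _ _ (queue_law_tail_0 rho s' ltac:(lra))); lra.
  - rewrite (is_series_unique _ _ (queue_law_tail_S rho s ltac:(lra) M)).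
    rewrite (is_series_unique _ _ (queue_law_tail_S rho s' ltac:(lra) M)).
    apply Rmult_le_compat_l; [lra|]; now apply pow_incr.
Qed.

Lemma st_le_ext (p q p' q' : nat -> R) :
  (forall m, p m = p' m) -> (forall m, q m = q' m) -> st_le p' q' -> st_le p q.
Proof.
  intros Hp Hq H M.
  rewrite (Series_ext _ _ (fun m => Hp (M + m)%nat)).
  rewrite (Series_ext _ _ (fun m => Hq (M + m)%nat)); apply H.
Qed.

Lemma is_mean_ext (p q : nat -> R) (l : R) :
  (forall m, p m = q m) -> is_mean p l -> is_mean q l.
Proof.
  intros H; apply is_series_ext_R; intros m; now rewrite H.
Qed.

Lemma is_variance_ext (p q : nat -> R) (v : R) :
  (forall m, p m = q m) -> is_variance p v -> is_variance q v.
Proof.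
  intros H [l [Hl Hv]]; exists l; split; [now apply (is_mean_ext p)|].
  revert Hv; apply is_series_ext_R; intros m; now rewrite H.
Qed.

Lemma geometric_mean_sojourn (mu s : R) (b : nat -> R) :
  0 < mu -> 0 <= s < 1 -> (forall m, b m = (1 - s) * s ^ m) ->
  is_mean_sojourn mu b (/ (mu * (1 - s))).
Proof.
  intros Hmu Hs Hb; unfold is_mean_sojourn.
  pose proof (quadratic_geom_series ((1 - s) / mu) ((1 - s) / mu) 0 s Hs) as H.
  replace (/ (mu * (1 - s))) with
    ((1 - s) / mu / (1 - s) + (1 - s) / mu * s / (1 - s) ^ 2
       + 0 * s * (1 + s) / (1 - s) ^ 3) by (field; lra).
  revert H; apply is_series_ext_R; intros n.
  rewrite Hb, S_INR; unfold Rdiv; ring.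
Qed.

(** * The E_k/M/1 queue *)

Lemma sum_n_geom (x : R) (n : nat) : (1 - x) * sum_n (fun i => x ^ i) n = 1 - x ^ S n.
Proof.
  induction n as [|n IH]; [rewrite sum_n_0; simpl; ring|].
  rewrite sum_n_S, Rmult_plus_distr_l, IH; simpl; ring.
Qed.

Lemma sum_n_shift (u v : nat -> R) (K : nat) :
  (forall j, v (S j) = u j) -> sum_n v K = v 0%nat + sum_n u K - u K :> R.
Proof.
  intros H; induction K as [|K IH]; [rewrite !sum_n_0; ring|].
  rewrite !sum_n_S, IH, H; ring.
Qed.

Lemma sum_n_lim (u : nat -> nat -> R) (K : nat) :
  (forall j, (j <= K)%nat -> is_lim_seq (fun m => u m j) 0) ->
  is_lim_seq (fun m => sum_n (u m) K) 0.
Proof.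
  induction K as [|K IH]; intros H.
  - apply is_lim_seq_ext with (fun m => u m 0%nat); [|apply H; lia].
    intros m; now rewrite sum_n_0.
  - apply is_lim_seq_ext with (fun m => sum_n (u m) K + u m (S K)).
    + intros m; now rewrite sum_n_S.
    + replace 0 with (0 + 0) by ring.
      apply is_lim_seq_plus'; [apply IH; intros j Hj|]; apply H; lia.
Qed.

(** * Vanishing of decaying solutions of the balance equations *)

Section PhaseChain.

Variables (nu mu : R) (K : nat) (d : nat -> nat -> R).
Hypotheses (Hnu : 0 < nu) (Hmu : 0 < mu).
Hypothesis Hbal : forall m j, (j <= K)%nat ->
  d (S m) j * (nu + mu) =
  nu * match j with O => d m K | S j' => d (S m) j' end + mu * d (S (S m)) j.
Hypothesis Hlim : forall j, (j <= K)%nat -> is_lim_seq (fun m => d m j) 0.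

Let T (m : nat) : R := sum_n (fun j => Rabs (d m j)) K.

(** Triangle inequality in the balance equations, summed over the phases of level m + 1. The sum of
    the phase inflows is [T (S m)] with [Rabs (d m K)] in place of [Rabs (d (S m) K)], so
    [nu * T (S m)] cancels. *)
Lemma phase_level_decay (m : nat) :
  mu * T (S m) + nu * Rabs (d (S m) K) <= nu * Rabs (d m K) + mu * T (S (S m)).
Proof.
  set (prev := fun j => match j with O => d m K | S j' => d (S m) j' end).
  assert (H : (nu + mu) * T (S m) <=
    nu * sum_n (fun j => Rabs (prev j)) K + mu * T (S (S m))).
  { unfold T; rewrite <- !sum_n_scal, <- sum_n_add.
    apply sum_n_le; intros j Hj.
    rewrite <- (Rabs_pos_eq (nu + mu)), <- Rabs_mult, Rmult_comm by lra.
    rewrite Hbal by exact Hj; eapply Rle_trans; [apply Rabs_triang|].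
    rewrite !Rabs_mult, (Rabs_pos_eq nu), (Rabs_pos_eq mu) by lra.
    apply Rle_refl. }
  rewrite (sum_n_shift (fun j => Rabs (d (S m) j))) in H by reflexivity.
  unfold prev in H; fold (T (S m)) in H; lra.
Qed.

Lemma phase_chain_step (m : nat) : d m K = 0 -> forall j, (j <= K)%nat -> d (S m) j = 0.
Proof.
  intros H0 j Hj.
  assert (Hm : forall n, mu * T (S m) <= mu * T (S (n + m))).
  { intros n.
    (* The term in [d (n + m) K] is kept on the left because it is what the next application of
       [phase_level_decay] consumes. *)
    enough (mu * T (S m) + nu * Rabs (d (n + m)%nat K) <= mu * T (S (n + m)))
      by (pose proof (Rabs_pos (d (n + m)%nat K)); nra).
    induction n as [|n IH].
    - simpl; rewrite H0, Rabs_R0; lra.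
    - pose proof (phase_level_decay (n + m)); simpl in *; lra. }
  assert (HT : is_lim_seq T 0).
  { apply (sum_n_lim (fun m j => Rabs (d m j))); intros i Hi.
    apply -> is_lim_seq_abs_0; now apply Hlim. }
  assert (H1 : mu * T (S m) <= mu * 0).
  { apply (is_lim_seq_le (fun _ => mu * T (S m)) (fun n => mu * T (n + S m)%nat)
      (mu * T (S m)) (mu * 0)).
    - intros n; replace (n + S m)%nat with (S (n + m)) by lia; apply Hm.
    - apply is_lim_seq_const.
    - apply (is_lim_seq_scal_l (fun n => T (n + S m)%nat) mu 0).
      now apply (is_lim_seq_incr_n T). }
  assert (H2 : Rabs (d (S m) j) <= T (S m)).
  { apply (term_le_sum_n (fun j => Rabs (d (S m) j))); [|exact Hj].
    intros; apply Rabs_pos. }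
  apply Rabs_eq_0; pose proof (Rabs_pos (d (S m) j)); nra.
Qed.

Lemma phase_chain_zero : d 0%nat K = 0 -> forall m j, (j <= K)%nat -> d (S m) j = 0.
Proof.
  intros H0 m; induction m as [|m IH]; intros j Hj.
  - now apply phase_chain_step.
  - apply phase_chain_step; [apply IH; lia | exact Hj].
Qed.

End PhaseChain.

(* [z ^ S K] is the ratio sigma of the geometric law when k = K + 1. *)
Definition phase_root (rho : R) (K : nat) (z : R) : Prop :=
  0 < z < 1 /\ sum_n (fun i => z ^ S i) K = INR (S K) * rho :> R.

Lemma phase_sum_closed (z : R) (K : nat) :
  (1 - z) * sum_n (fun i => z ^ S i) K = z * (1 - z ^ S K).
Proof.
  rewrite <- sum_n_geom, <- Rmult_assoc, (Rmult_comm z), Rmult_assoc; f_equal.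
  apply (sum_n_scal z (fun i => z ^ i)).
Qed.

Lemma phase_sum_continuity (K : nat) : continuity (fun x => sum_n (fun i => x ^ S i) K).
Proof.
  induction K as [|K IH].
  - intros x; apply continuity_pt_ext with (fun x => x ^ 1).
    + intros y; now rewrite sum_n_0.
    + apply derivable_continuous_pt, derivable_pt_pow.
  - intros x.
    apply continuity_pt_ext with (fun x => sum_n (fun i => x ^ S i) K + x ^ S (S K)).
    + intros y; now rewrite sum_n_S.
    + apply (continuity_pt_plus (fun x => sum_n (fun i => x ^ S i) K)
        (fun x => x ^ S (S K))); [apply IH|].
      apply derivable_continuous_pt, derivable_pt_pow.
Qed.

(** Intermediate value theorem with k = K + 1: the difference of the two sides is - k rho at 0 and k
    (1 - rho) at 1, positive by stability. The sig type lets a root be chosen for every K by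
    projection. *)
Lemma phase_root_exists (rho : R) (K : nat) :
  0 < rho < 1 -> {z : R | phase_root rho K z}.
Proof.
  intros Hrho.
  assert (HK : 0 < INR (S K)) by (apply lt_0_INR; lia).
  set (f := fun x => sum_n (fun i => x ^ S i) K - INR (S K) * rho).
  assert (H0 : f 0 < 0).
  { unfold f; rewrite (sum_n_ext _ (fun _ => 0)) by (intros; apply pow_i; lia).
    rewrite sum_n_const; nra. }
  assert (H1 : 0 < f 1).
  { unfold f; rewrite (sum_n_ext _ (fun _ => 1)) by (intros; apply pow1).
    rewrite sum_n_const; nra. }
  destruct (IVT f 0 1) as [z [Hz Hfz]]; [|lra|exact H0|exact H1|].
  - apply continuity_minus; [apply phase_sum_continuity|].
    apply continuity_const; now intros x y.
  - exists z; split; [|unfold f in Hfz; lra].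
    split; apply Rnot_le_lt; intros H.
    + replace z with 0 in Hfz by lra; lra.
    + replace z with 1 in Hfz by lra; lra.
Qed.

(** * The stationary law of the phase chain *)

Section ErlangQueue.

Variables (lam mu z : R) (K : nat) (p : nat -> nat -> R).
Hypotheses (Hlam : 0 < lam) (Hmu : 0 < mu) (Hz : phase_root (lam / mu) K z).
Hypothesis Hp : EkM1_stationary lam mu (S K) p.

Let nu : R := INR (S K) * lam.
Let s : R := z ^ S K.
(** Calibrated so that the trial solution C z^(m (K + 1) + j) agrees with [p] at (0, K). *)
Let C : R := p 0%nat K / z ^ K.

(** Rearranged, z (nu + mu) = nu + mu z s: this is the balance at a busy level for z^(m (K + 1) +
    j), since a phase multiplies it by z and a level by s. It is the root equation multiplied by 1 -
    z. *)
Lemma phase_root_balance : nu * (1 - z) = mu * z * (1 - s).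
Proof.
  destruct Hz as [_ H]; pose proof (phase_sum_closed z K) as Hc.
  rewrite H in Hc; unfold nu, s; rewrite (Rmult_assoc mu), <- Hc; field; lra.
Qed.

Lemma phase_sigma_bounds : 0 < s < 1.
Proof.
  destruct Hz as [Hz01 _]; unfold s; split; [apply pow_lt; lra|].
  apply pow_lt_1_compat; [lra|lia].
Qed.

Lemma stationary_phase_lim (j : nat) : (j <= K)%nat -> is_lim_seq (fun m => p m j) 0.
Proof.
  intros Hj; destruct Hp as [Hpos [Hsum _]].
  apply is_lim_seq_le_le with (fun _ => 0) (EkM1_customers (S K) p).
  - intros m; split; [apply Hpos; lia|].
    unfold EkM1_customers; apply (term_le_sum_n (p m)); [|lia].
    intros i Hi; apply Hpos; lia.
  - apply is_lim_seq_const.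
  - apply ex_series_lim_0; eexists; exact Hsum.
Qed.

(** The difference from the trial solution satisfies the linear balance equations, tends to 0 and
    vanishes at (0, K), so [phase_chain_zero] applies. Level 0, where nobody is served, is left to
    [stationary_idle_phase]. *)
Lemma stationary_geometric_S (m j : nat) :
  (j <= K)%nat -> p (S m) j = C * z ^ (S m * S K + j).
Proof.
  intros Hj; pose proof Hz as [Hz01 _]; pose proof Hp as [_ [_ Hbal]].
  assert (Hnu : 0 < nu) by (apply Rmult_lt_0_compat; [apply lt_0_INR; lia|lra]).
  pose proof phase_root_balance as Hroot.
  set (d := fun m j => p m j - C * z ^ (m * S K + j)).
  enough (d (S m) j = 0) by (unfold d in *; lra).
  apply (phase_chain_zero nu mu K d Hnu Hmu); [| | |exact Hj]; clear m j Hj.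
  - intros m j Hj; unfold d.
    specialize (Hbal (S m) j ltac:(lia)); unfold EkM1_exit_rate in Hbal.
    fold nu in Hbal.
    replace (z ^ (S (S m) * S K + j)) with (s * z ^ (S m * S K + j))
      by (unfold s; rewrite <- pow_add; f_equal; lia).
    (* In the single numbering m (K + 1) + j the predecessor of (m + 1, 0) is (m, K), so in both
       cases the inflow comes from one exponent lower. *)
    destruct j as [|j]; unfold EkM1_phase_inflow in Hbal; fold nu in Hbal.
    + rewrite Nat.sub_succ, Nat.sub_0_r in Hbal.
      replace (z ^ (S m * S K + 0)) with (z * z ^ (m * S K + K))
        by (change (z * z ^ (m * S K + K)) with (z ^ S (m * S K + K)); f_equal; lia).
      set (x := z ^ (m * S K + K)).
      apply Rminus_diag_uniq.
      transitivity (p (S m) 0%nat * (nu + mu)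
        - (nu * p m K + mu * p (S (S m)) 0%nat)
        + C * x * (nu * (1 - z) - mu * z * (1 - s))); [ring|].
      rewrite Hbal, Hroot; ring.
    + replace (z ^ (S m * S K + S j)) with (z * z ^ (S m * S K + j))
        by (change (z * z ^ (S m * S K + j)) with (z ^ S (S m * S K + j)); f_equal; lia).
      set (x := z ^ (S m * S K + j)).
      apply Rminus_diag_uniq.
      transitivity (p (S m) (S j) * (nu + mu)
        - (nu * p (S m) j + mu * p (S (S m)) (S j))
        + C * x * (nu * (1 - z) - mu * z * (1 - s))); [ring|].
      rewrite Hbal, Hroot; ring.
  - intros j Hj; unfold d; replace 0 with (0 - C * z ^ j * 0) by ring.
    apply is_lim_seq_minus'; [now apply stationary_phase_lim|].
    apply is_lim_seq_ext with (fun m => C * z ^ j * s ^ m).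
    + intros m; unfold s; rewrite <- pow_mult, pow_add, (Nat.mul_comm m); ring.
    + apply (is_lim_seq_scal_l _ (C * z ^ j) 0), is_lim_seq_geom.
      pose proof phase_sigma_bounds; rewrite Rabs_pos_eq; lra.
  - unfold d, C; simpl; field; apply pow_nonzero; lra.
Qed.

Lemma stationary_at_arrival (m : nat) : p m K = p 0%nat K * s ^ m.
Proof.
  destruct Hz as [Hz01 _]; destruct m as [|m]; [simpl; ring|].
  rewrite stationary_geometric_S by lia.
  unfold C, s; rewrite <- pow_mult, pow_add, (Nat.mul_comm (S m)).
  field; apply pow_nonzero; lra.
Qed.

(** With [stationary_at_arrival] this is the balance of flows between levels m and m + 1: mu times
    the mass of level m + 1 equals [nu * p m K]. It is obtained by summing the geometric form over
    the phases. *)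
Lemma stationary_customers_S (m : nat) :
  EkM1_customers (S K) p (S m) = nu / mu * p 0%nat K * s ^ m.
Proof.
  destruct Hz as [Hz01 _]; pose proof phase_root_balance as Hroot.
  unfold EkM1_customers; rewrite Nat.sub_succ, Nat.sub_0_r.
  transitivity (sum_n (fun j => C * z ^ (S m * S K) * z ^ j) K).
  { apply sum_n_ext_loc; intros j Hj.
    rewrite stationary_geometric_S, pow_add by exact Hj; symmetry; apply Rmult_assoc. }
  rewrite (sum_n_scal _ (fun j => z ^ j)).
  pose proof (sum_n_geom z K) as Hg; fold s in Hg.
  apply Rmult_eq_reg_l with (1 - z); [|lra].
  transitivity (C * z ^ (S m * S K) * (1 - s)); [rewrite <- Hg; ring|].
  transitivity (nu * (1 - z) / mu * p 0%nat K * s ^ m); [|field; lra].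
  rewrite Hroot; unfold C.
  replace (z ^ (S m * S K)) with (z * z ^ K * s ^ m)
    by (unfold s; rewrite <- pow_mult; change (z * z ^ K) with (z ^ S K);
        rewrite <- pow_add; f_equal; lia).
  field; split; [lra|apply pow_nonzero; lra].
Qed.

(** At level 0 the balance equations give [p 0 j] from [p 0 (j - 1)] by adding mu / nu times the
    known [p 1 j]; the root equation turns each increment into a difference of successive powers of
    z, and these telescope. *)
Lemma stationary_idle_phase (j : nat) : (j <= K)%nat ->
  p 0%nat j * (1 - s) = p 0%nat K * (1 - z ^ S j).
Proof.
  pose proof Hz as [Hz01 _]; pose proof Hp as [_ [_ Hbal]].
  assert (Hnu : 0 < nu) by (apply Rmult_lt_0_compat; [apply lt_0_INR; lia|lra]).
  pose proof phase_root_balance as Hroot.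
  assert (HC : C * s = p 0%nat K * z).
  { unfold C, s; simpl; field; apply pow_nonzero; lra. }
  induction j as [|j IH]; intros Hj;
    specialize (Hbal 0%nat _ (le_n_S _ _ Hj)); unfold EkM1_exit_rate in Hbal;
    unfold EkM1_phase_inflow in Hbal; fold nu in Hbal;
    rewrite stationary_geometric_S in Hbal by exact Hj;
    rewrite pow_add, Nat.mul_1_l in Hbal; fold s in Hbal;
    apply Rmult_eq_reg_l with nu; try lra.
  - transitivity (p 0%nat 0%nat * (nu + 0) * (1 - s)); [ring|].
    rewrite Hbal.
    transitivity (mu * (C * s) * (1 - s)); [simpl; ring|].
    rewrite HC.
    transitivity (p 0%nat K * (mu * z * (1 - s))); [ring|].
    rewrite <- Hroot; simpl; ring.
  - transitivity (p 0%nat (S j) * (nu + 0) * (1 - s)); [ring|].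
    rewrite Hbal.
    transitivity (nu * (p 0%nat j * (1 - s)) + mu * (C * s) * z ^ S j * (1 - s));
      [ring|].
    rewrite HC, IH by lia.
    transitivity (nu * p 0%nat K * (1 - z ^ S j)
      + p 0%nat K * z ^ S j * (mu * z * (1 - s))); [ring|].
    rewrite <- Hroot; simpl; ring.
Qed.

Lemma stationary_customers_0 :
  EkM1_customers (S K) p 0 * (1 - s) = p 0%nat K * INR (S K) * (1 - lam / mu).
Proof.
  pose proof Hz as [_ Hsum].
  unfold EkM1_customers; rewrite Nat.sub_succ, Nat.sub_0_r.
  transitivity (sum_n (fun j => p 0%nat K + - p 0%nat K * z ^ S j) K).
  { rewrite Rmult_comm, <- (sum_n_scal (1 - s)); apply sum_n_ext_loc; intros j Hj.
    pose proof (stationary_idle_phase j Hj) as H.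
    change ((1 - s) * p 0%nat j = p 0%nat K + - p 0%nat K * z ^ S j :> R).
    rewrite Rmult_comm, H; ring. }
  rewrite (sum_n_add (fun _ => p 0%nat K)), (sum_n_scal (- p 0%nat K)), Hsum.
  rewrite sum_n_const; ring.
Qed.

(** Total mass 1 fixes the free constant: after multiplication by 1 - s, level 0 contributes (K + 1)
    (1 - rho) [p 0 K] and the busy levels (K + 1) rho [p 0 K], where rho = lam / mu. *)
Lemma stationary_normalization : p 0%nat K * INR (S K) = 1 - s.
Proof.
  pose proof phase_sigma_bounds as Hs; pose proof Hp as [_ [Hsum _]].
  pose proof (geom_series (nu / mu * p 0%nat K) s ltac:(lra)) as H.
  apply (is_series_ext_R _ (fun m => EkM1_customers (S K) p (S m))) in H;
    [|intros; symmetry; apply stationary_customers_S].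
  apply is_series_cons in H.
  pose proof (is_series_unique _ _ H) as H1.
  rewrite (is_series_unique _ _ Hsum) in H1.
  pose proof stationary_customers_0 as H0.
  apply Rmult_eq_compat_r with (r := 1 - s) in H1.
  rewrite Rmult_plus_distr_r, H0 in H1.
  transitivity (1 * (1 - s)); [|ring].
  rewrite H1; unfold nu; field; lra.
Qed.

Lemma EkM1_customers_law (m : nat) :
  EkM1_customers (S K) p m = queue_law (lam / mu) (z ^ S K) m.
Proof.
  fold s; pose proof phase_sigma_bounds as Hs.
  pose proof stationary_normalization as Hn; destruct m as [|m]; simpl queue_law.
  - apply Rmult_eq_reg_r with (1 - s); [|lra].
    rewrite stationary_customers_0, Hn; ring.
  - rewrite stationary_customers_S, <- Hn; unfold nu; field; lra.
Qed.

Lemma EkM1_at_arrival_law (m : nat) :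
  EkM1_at_arrival (S K) p m = (1 - z ^ S K) * (z ^ S K) ^ m.
Proof.
  fold s; pose proof phase_sigma_bounds as Hs.
  pose proof stationary_normalization as Hn.
  assert (H0 : p 0%nat K <> 0) by (intros H; rewrite H in Hn; lra).
  unfold EkM1_at_arrival; rewrite Nat.sub_succ, Nat.sub_0_r.
  rewrite (Series_ext _ _ stationary_at_arrival), stationary_at_arrival.
  rewrite (is_series_unique _ _ (geom_series (p 0%nat K) s ltac:(lra))).
  field; split; [lra|exact H0].
Qed.

End ErlangQueue.

(** * Monotonicity and limit of sigma_k *)

Lemma bernoulli (x : R) (n : nat) : -1 <= x -> 1 + INR n * x <= (1 + x) ^ n.
Proof.
  intros Hx; induction n as [|n IH]; [simpl; lra|].
  rewrite S_INR; simpl pow.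
  apply Rle_trans with ((1 + x) * (1 + INR n * x)).
  - pose proof (pos_INR n); pose proof (Rle_0_sqr x); unfold Rsqr in *; nra.
  - apply Rmult_le_compat_l; [lra|exact IH].
Qed.

(** Bernoulli's inequality applied to the ratio of the two bases. *)
Lemma compound_interest_le (w : R) (n : nat) : (1 <= n)%nat -> 0 < w ->
  (1 + w / INR n) ^ n <= (1 + w / INR (S n)) ^ S n.
Proof.
  intros Hn Hw.
  assert (Hn0 : 1 <= INR n) by (now apply (le_INR 1)).
  rewrite S_INR.
  set (a := 1 + w / INR n); set (b := 1 + w / (INR n + 1)).
  assert (Ha : 0 < a) by (unfold a; pose proof (Rdiv_lt_0_compat w (INR n)); lra).
  (* This is b / a - 1. It satisfies 1 + (n + 1) x = 1 / a, so the lower bound from Bernoulli is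
     exactly a^n. *)
  set (x := - (w / ((INR n + 1) * (INR n + w)))).
  assert (Hx : -1 <= x).
  { assert (Hd : 0 < (INR n + 1) * (INR n + w)) by nra.
    enough (w / ((INR n + 1) * (INR n + w)) <= 1) by (unfold x; lra).
    apply Rmult_le_reg_r with (1 := Hd).
    unfold Rdiv; rewrite Rmult_assoc, Rinv_l by lra; nra. }
  replace b with ((1 + x) * a) by (unfold a, b, x; field; nra).
  rewrite Rpow_mult_distr.
  apply Rle_trans with ((1 + INR (S n) * x) * a ^ S n).
  - right; rewrite S_INR; simpl; unfold x, a; field; nra.
  - apply Rmult_le_compat_r; [apply pow_le; lra|now apply bernoulli].
Qed.

Lemma pow_root_exists (s : R) (n : nat) : 0 < s -> exists t, 0 < t /\ t ^ S n = s.
Proof.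
  intros Hs; exists (Rpower s (/ INR (S n))); split; [apply exp_pos|].
  rewrite <- Rpower_pow, Rpower_mult by apply exp_pos.
  rewrite Rinv_l by (apply not_0_INR; lia); now apply Rpower_1.
Qed.

(** The k-th root of sigma (1 + w / k)^k = 1, where k = K + 1, sigma = z^k and w = (1 - sigma) /
    rho. *)
Lemma phase_root_formula (rho z : R) (K : nat) : 0 < rho -> phase_root rho K z ->
  z * (1 + (1 - z ^ S K) / rho / INR (S K)) = 1.
Proof.
  intros Hrho [Hz Hsum]; pose proof (phase_sum_closed z K) as H; rewrite Hsum in H.
  assert (HK : 0 < INR (S K)) by (apply lt_0_INR; lia).
  transitivity (z + z * (1 - z ^ S K) / (INR (S K) * rho)); [field; lra|].
  rewrite <- H; field; lra.
Qed.

(** The phase sum is strictly increasing on the positive axis. *)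
Lemma phase_root_le (rho z t : R) (K : nat) : phase_root rho K z -> 0 < t ->
  INR (S K) * rho <= sum_n (fun i => t ^ S i) K -> z <= t.
Proof.
  intros [Hz Hsum] Ht H; apply Rnot_lt_le; intros Hlt; rewrite <- Hsum in H.
  revert H; apply Rlt_not_le; clear Hsum.
  assert (Hpow : forall i, t ^ S i < z ^ S i).
  { intros i; induction i as [|i IH]; [simpl; lra|].
    change (t * t ^ S i < z * z ^ S i); pose proof (pow_lt t (S i) Ht); nra. }
  induction K as [|K IH]; [rewrite !sum_n_0; apply Hpow|].
  rewrite !sum_n_S; apply Rplus_lt_compat; [exact IH|apply Hpow].
Qed.

(** A test for candidates s above sigma_k, k = K + 1. For the k-th root t of s the hypothesis
    becomes t (1 + (1 - s) / (k rho)) >= 1, that is, t (1 - s) >= (1 - t) k rho; so the phase sum at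
    t is at least k rho and z <= t. *)
Lemma phase_sigma_le (rho z s : R) (K : nat) :
  0 < rho -> phase_root rho K z -> 0 < s < 1 ->
  1 <= s * (1 + (1 - s) / rho / INR (S K)) ^ S K -> z ^ S K <= s.
Proof.
  intros Hrho Hz Hs H.
  assert (HK : 0 < INR (S K)) by (apply lt_0_INR; lia).
  destruct (pow_root_exists s K (proj1 Hs)) as [t [Ht Hts]].
  rewrite <- Hts; apply pow_incr; split; [apply Rlt_le, Hz|].
  assert (Ht1 : t < 1).
  { apply Rnot_le_lt; intros Hle; pose proof (pow_R1_Rle t (S K) Hle); lra. }
  assert (Hc : 0 < (1 - s) / rho / INR (S K)).
  { unfold Rdiv; repeat apply Rmult_lt_0_compat; try apply Rinv_0_lt_compat; lra. }
  assert (H1 : 1 <= t * (1 + (1 - s) / rho / INR (S K))).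
  { apply Rnot_lt_le; intros Hlt.
    rewrite <- Hts, <- Rpow_mult_distr, Hts in H; revert H; apply Rlt_not_le.
    apply pow_lt_1_compat; [split; [apply Rmult_le_pos|]|lia]; lra. }
  apply (phase_root_le rho z t K Hz Ht).
  apply Rmult_le_reg_l with (1 - t); [lra|].
  rewrite phase_sum_closed, Hts.
  replace (t * (1 - s)) with
    ((t * (1 + (1 - s) / rho / INR (S K)) - t) * (INR (S K) * rho)) by (field; lra).
  apply Rmult_le_compat_r; [nra|lra].
Qed.

(** The candidate s = sigma_k passes the test for k + 1: s (1 + w / k)^k is 1, and
    [compound_interest_le] only enlarges it. *)
Lemma phase_sigma_decr (rho z z' : R) (K : nat) : 0 < rho ->
  phase_root rho K z -> phase_root rho (S K) z' -> z' ^ S (S K) <= z ^ S K.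
Proof.
  intros Hrho Hz Hz'.
  assert (Hs : 0 < z ^ S K < 1).
  { split; [apply pow_lt, Hz|apply pow_lt_1_compat; [pose proof (proj1 Hz); lra|lia]]. }
  apply phase_sigma_le with rho; auto.
  set (w := (1 - z ^ S K) / rho).
  assert (Hw : 0 < w) by (apply Rdiv_lt_0_compat; lra).
  apply Rle_trans with (z ^ S K * (1 + w / INR (S K)) ^ S K).
  - rewrite <- Rpow_mult_distr; unfold w; rewrite phase_root_formula by assumption.
    rewrite pow1; lra.
  - apply Rmult_le_compat_l; [lra|]; apply compound_interest_le; [lia|exact Hw].
Qed.

Lemma exp_pow (x : R) (n : nat) : exp x ^ n = exp (INR n * x).
Proof.
  induction n as [|n IH]; [simpl; now rewrite Rmult_0_l, exp_0|].
  rewrite S_INR; simpl pow; rewrite IH, <- exp_plus; f_equal; ring.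
Qed.

(** With u = w / k, k = K + 1, the root is z = 1 / (1 + u). The inequality 1 + x <= exp x at x = u
    and at x = - u / (1 + u) encloses z between exponentials, which are then raised to the power
    k. *)
Lemma phase_sigma_exp_bounds (rho z w : R) (K : nat) : 0 < rho ->
  phase_root rho K z -> w = (1 - z ^ S K) / rho ->
  exp (- w) <= z ^ S K <= exp (- (w / (1 + w / INR (S K)))).
Proof.
  intros Hrho Hz Hw.
  assert (HK : 0 < INR (S K)) by (apply lt_0_INR; lia).
  pose proof (phase_root_formula rho z K Hrho Hz) as Hf; rewrite <- Hw in Hf.
  assert (Hs : z ^ S K < 1).
  { apply pow_lt_1_compat; [pose proof (proj1 Hz); lra|lia]. }
  assert (Hw0 : 0 < w) by (subst w; apply Rdiv_lt_0_compat; lra).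
  set (u := w / INR (S K)) in *.
  assert (Hu : 0 < u) by (apply Rdiv_lt_0_compat; lra).
  assert (Hzu : z = / (1 + u)).
  { apply Rmult_eq_reg_r with (1 + u); [|lra]; rewrite Hf; field; lra. }
  split.
  - replace (- w) with (INR (S K) * - u) by (unfold u; field; lra).
    rewrite <- exp_pow; apply pow_incr; split; [apply Rlt_le, exp_pos|].
    rewrite Hzu, exp_Ropp; apply Rinv_le_contravar; [lra|apply exp_ineq1_le].
  - replace (- (w / (1 + u))) with (INR (S K) * - (u / (1 + u)))
      by (unfold u in *; field; split; nra).
    rewrite <- exp_pow; apply pow_incr; split; [apply Rlt_le, Hz|].
    eapply Rle_trans; [|apply exp_ineq1_le].
    rewrite Hzu; right; field; lra.
Qed.

(** The limit exists by monotonicity, and both exponential bounds converge to exp (- (1 - s) / rho),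
    which identifies it. This also supplies the root needed for D/M/1. *)
Lemma phase_sigma_limit (rho : R) (z : nat -> R) : 0 < rho ->
  (forall K, phase_root rho K (z K)) ->
  exists s : R, is_lim_seq (fun K => z K ^ S K) s /\ s < 1 /\ s = exp (- ((1 - s) / rho)).
Proof.
  intros Hrho Hz; set (sg := fun K => z K ^ S K).
  assert (Hdecr : forall K, sg (S K) <= sg K)
    by (intros K; now apply phase_sigma_decr with rho).
  destruct (ex_finite_lim_seq_decr sg 0 Hdecr) as [s Hs].
  { intros K; apply pow_le, Rlt_le, Hz. }
  (* The value 1 also solves the limit equation; it is excluded because s lies below sigma_1 < 1. *)
  assert (Hs1 : s < 1).
  { pose proof (is_lim_seq_decr_compare sg s Hs Hdecr 0%nat) as H.
    pose proof (proj1 (Hz 0%nat)); unfold sg in H; simpl in H; lra. }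
  exists s; split; [exact Hs|split; [exact Hs1|]].
  set (w := fun K => (1 - sg K) / rho).
  assert (Hw : is_lim_seq w ((1 - s) / rho)).
  { unfold w, Rdiv; apply (is_lim_seq_scal_r _ (/ rho) (1 - s)).
    apply is_lim_seq_minus'; [apply is_lim_seq_const|exact Hs]. }
  assert (Hexp : forall (v : nat -> R) (l : R), is_lim_seq v l ->
    is_lim_seq (fun K => exp (- v K)) (exp (- l))).
  { intros v l Hv; apply (is_lim_seq_continuous exp); [|exact (proj1 (is_lim_seq_opp v l) Hv)].
    apply derivable_continuous_pt, derivable_pt_exp. }
  assert (Hw' : is_lim_seq (fun K => w K / (1 + w K / INR (S K))) ((1 - s) / rho)).
  { replace ((1 - s) / rho) with ((1 - s) / rho / (1 + (1 - s) / rho * 0))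
      by (field; lra).
    apply is_lim_seq_div'; [exact Hw| |lra].
    apply is_lim_seq_plus'; [apply is_lim_seq_const|].
    apply is_lim_seq_mult'; [exact Hw|].
    apply (is_lim_seq_inv (fun K => INR (S K)) p_infty); [|discriminate].
    now apply -> (is_lim_seq_incr_1 INR); apply is_lim_seq_INR. }
  assert (Hu : is_lim_seq sg (exp (- ((1 - s) / rho)))).
  { apply is_lim_seq_le_le with (fun K => exp (- w K))
      (fun K => exp (- (w K / (1 + w K / INR (S K))))); [|now apply Hexp|now apply Hexp].
    intros K; now apply phase_sigma_exp_bounds with rho. }
  pose proof (is_lim_seq_unique _ _ Hs) as E1.
  rewrite (is_lim_seq_unique _ _ Hu) in E1; now injection E1.
Qed.

(** * The D/M/1 queue *)

Lemma ex_series_dominated (u v : nat -> R) :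
  (forall n, Rabs (u n) <= v n) -> ex_series v -> ex_series u.
Proof. exact (ex_series_le (V := R_CompleteNormedModule) u v). Qed.

Lemma is_series_minus_R (u v : nat -> R) (k l : R) :
  is_series u k -> is_series v l -> is_series (fun n => u n - v n) (k - l).
Proof. exact (is_series_minus u v k l). Qed.

Lemma is_series_sum_n_terms (u : nat -> nat -> R) (l : nat -> R) (N : nat) :
  (forall m, is_series (u m) (l m)) ->
  is_series (fun i => sum_n (fun m => u m i) N) (sum_n l N).
Proof.
  intros H; induction N as [|N IH].
  - rewrite sum_n_0; apply is_series_ext_R with (u 0%nat); [|apply H].
    intros i; now rewrite sum_n_0.
  - rewrite sum_n_S.
    apply is_series_ext_R with (fun i => sum_n (fun m => u m i) N + u (S N) i).
    + intros i; now rewrite sum_n_S.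
    + exact (is_series_plus _ _ _ _ IH (H (S N))).
Qed.

Lemma series_term_le (u : nat -> R) (l : R) (j : nat) :
  (forall i, 0 <= u i) -> is_series u l -> u j <= l.
Proof.
  intros Hu Hl; apply Rle_trans with (sum_n u j).
  - apply term_le_sum_n; auto.
  - now apply partial_sum_le.
Qed.

(** The index j lies to the left of the window l, ..., l + N. *)
Lemma shifted_sum_le (u : nat -> R) (D : R) (N j l : nat) :
  (forall i, 0 <= u i) -> is_series u D -> (j < l)%nat ->
  sum_n (fun m => u (m + l)%nat) N + u j <= D.
Proof.
  intros Hu HD Hj.
  apply Rle_trans with (sum_n u (N + l)); [|now apply partial_sum_le].
  induction N as [|N IH].
  - rewrite sum_n_0; simpl; destruct l as [|l]; [lia|].
    rewrite sum_n_S; enough (u j <= sum_n u l) by lra.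
    apply term_le_sum_n; [auto|lia].
  - simpl Nat.add; rewrite !sum_n_S; simpl Nat.add; lra.
Qed.

(* Summing the hypothesis over m gives [sum |d| <= sum_l beta l * sum_(i >= l) |d i|],
   which is less than [sum |d|] as soon as some [d j] is nonzero. *)
Lemma backward_recursion_zero (beta d : nat -> R) :
  (forall l, 0 < beta l) -> is_series beta 1 ->
  ex_series (fun m => Rabs (d m)) -> d 0%nat = 0 ->
  (forall m, Rabs (d (S m)) <= Series (fun l => beta l * Rabs (d (m + l)%nat))) ->
  forall j, d j = 0.
Proof.
  intros Hb Hb1 Habs Hd0 Hrec j.
  set (e := fun m => Rabs (d m)); set (D := Series e).
  assert (HD : is_series e D) by now apply Series_correct.
  assert (He : forall i, 0 <= e i) by (intros i; apply Rabs_pos).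
  set (E := fun N l => sum_n (fun m => e (m + l)%nat) N).
  assert (HE : forall N l, E N l <= D).
  { intros N [|l]; unfold E.
    - rewrite (sum_n_ext _ e) by (intros n; now rewrite Nat.add_0_r).
      now apply partial_sum_le.
    - pose proof (shifted_sum_le e D N 0 (S l) He HD ltac:(lia)).
      specialize (He 0%nat); lra. }
  assert (Hex : forall m, ex_series (fun l => beta l * e (m + l)%nat)).
  { intros m; apply (ex_series_dominated _ (fun l => beta l * D)).
    - intros l; specialize (Hb l); specialize (He (m + l)%nat) as Hl.
      rewrite Rabs_pos_eq by nra.
      apply Rmult_le_compat_l; [lra|]; now apply (series_term_le e).
    - exists (1 * D); exact (is_series_scal_r D beta 1 Hb1). }
  assert (Hj : forall N, sum_n (fun m => e (S m)) N <= D - beta (S j) * e j).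
  { intros N.
    assert (HS := is_series_sum_n_terms (fun m l => beta l * e (m + l)%nat)
      (fun m => Series (fun l => beta l * e (m + l)%nat)) N
      (fun m => Series_correct _ (Hex m))).
    set (A := sum_n (fun m => Series (fun l => beta l * e (m + l)%nat)) N) in HS.
    apply Rle_trans with A; [apply sum_n_le; intros; apply Hrec|].
    assert (Hgap : is_series (fun l => beta l * (D - E N l)) (1 * D - A)).
    { eapply is_series_ext_R;
        [|exact (is_series_minus_R _ _ _ _ (is_series_scal_r D beta 1 Hb1) HS)].
      intros l; unfold E; rewrite Rmult_minus_distr_l.
      f_equal; apply (sum_n_scal (beta l)). }
    (* All the gaps are nonnegative, and the one at l = j + 1 is at least [e j], because the window
       starting at j + 1 misses j. *)
    apply (series_term_le _ _ (S j)) in Hgap.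
    - pose proof (shifted_sum_le e D N j (S j) He HD ltac:(lia)) as H.
      fold (E N (S j)) in H; specialize (Hb (S j)); nra.
    - intros l; specialize (Hb l); specialize (HE N l); nra. }
  (* As [d 0 = 0], the series of the [e (S m)] still sums to all of D. *)
  assert (Hlim : D <= D - beta (S j) * e j).
  { assert (HD' : is_series (fun m => e (S m)) D).
    { apply is_series_incr_1; change (is_series e (D + e 0%nat)).
      replace (D + e 0%nat) with D by (unfold e; rewrite Hd0, Rabs_R0; ring).
      exact HD. }
    exact (is_lim_seq_le _ _ D (D - beta (S j) * e j) Hj HD'
      (is_lim_seq_const _)). }
  apply Rabs_eq_0; fold (e j); specialize (Hb (S j)); specialize (He j); nra.
Qed.

(** * Poisson generating functions and the service kernel *)

Lemma poisson_nonneg (x : R) (l : nat) : 0 <= x -> 0 <= poisson x l.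
Proof.
  intros Hx; unfold poisson; apply Rmult_le_pos.
  - apply Rmult_le_pos; [apply Rlt_le, exp_pos|now apply pow_le].
  - apply Rlt_le, Rinv_0_lt_compat, INR_fact_lt_0.
Qed.

Lemma poisson_pos (x : R) (l : nat) : 0 < x -> 0 < poisson x l.
Proof.
  intros Hx; unfold poisson; apply Rdiv_lt_0_compat; [|apply INR_fact_lt_0].
  apply Rmult_lt_0_compat; [apply exp_pos|now apply pow_lt].
Qed.

Lemma poisson_generating (x s : R) :
  is_series (fun l => poisson x l * s ^ l) (exp (- (x * (1 - s)))).
Proof.
  replace (- (x * (1 - s))) with (- x + x * s) by ring; rewrite exp_plus.
  pose proof (proj1 (is_pseries_R _ _ _) (is_exp_Reals (x * s))) as H.
  apply (is_series_scal_R (exp (- x))) in H; revert H.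
  apply is_series_ext_R; intros l; unfold poisson; rewrite Rpow_mult_distr.
  unfold Rdiv; ring.
Qed.

Lemma poisson_total (x : R) : is_series (poisson x) 1.
Proof.
  pose proof (poisson_generating x 1) as H.
  replace (- (x * (1 - 1))) with 0 in H by ring; rewrite exp_0 in H; revert H.
  apply is_series_ext_R; intros l; rewrite pow1; ring.
Qed.

(** The cumulative sum up to i is the probability that i + 1 customers are not all served, so this
    series is the probability that the server is still busy under the geometric arrival law. *)
Lemma poisson_cumulative_generating (x s : R) : 0 <= x -> 0 <= s < 1 ->
  is_series (fun i => (1 - s) * s ^ i * sum_n (poisson x) i) (exp (- (x * (1 - s)))).
Proof.
  intros Hx Hs; apply is_series_of_lim.
  set (G := sum_n (fun l => poisson x l * s ^ l)).
  (* Abel summation *)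
  apply is_lim_seq_ext with (fun n => G n - s ^ S n * sum_n (poisson x) n).
  - intros n; unfold G; induction n as [|n IH]; [rewrite !sum_n_0; simpl; ring|].
    rewrite (sum_n_S (fun i => (1 - s) * s ^ i * sum_n (poisson x) i)), <- IH.
    rewrite !sum_n_S; simpl; ring.
  - replace (exp (- (x * (1 - s)))) with (exp (- (x * (1 - s))) - 0) by ring.
    apply is_lim_seq_minus'; [exact (poisson_generating x s)|].
    apply is_lim_seq_le_le with (fun _ => 0) (fun n => s ^ S n).
    + intros n; pose proof (pow_le s (S n) (proj1 Hs)) as Hp.
      assert (0 <= sum_n (poisson x) n)
        by (apply sum_n_nonneg; intros; now apply poisson_nonneg).
      assert (sum_n (poisson x) n <= 1).
      { apply partial_sum_le; [intros; now apply poisson_nonneg|apply poisson_total]. }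
      split; nra.
    + apply is_lim_seq_const.
    + apply -> (is_lim_seq_incr_1 (fun n => s ^ n)); apply is_lim_seq_geom.
      rewrite Rabs_pos_eq; lra.
Qed.

Lemma Series_drop_zeros (u : nat -> R) (m : nat) :
  (forall i, (i < m)%nat -> u i = 0) -> Series u = Series (fun l => u (m + l)%nat).
Proof.
  revert u; induction m as [|m IH]; intros u H; [reflexivity|].
  rewrite Series_incr_1_aux by (apply H; lia).
  rewrite IH by (intros; apply H; lia).
  reflexivity.
Qed.

(** Passing from i + 1 to m + 1 customers takes l = i - m services; indices i < m contribute 0. *)
Lemma DM1_after_S (mu t : R) (a : nat -> R) (m : nat) :
  DM1_after mu a t (S m) = Series (fun l => poisson (mu * t) l * a (m + l)%nat).
Proof.
  unfold DM1_after; rewrite (Series_drop_zeros _ m).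
  - apply Series_ext; intros l; unfold service_kernel.
    rewrite (proj2 (Nat.leb_le (S m) (S (m + l)))) by lia.
    replace (S (m + l) - S m)%nat with l by lia; ring.
  - intros i Hi; unfold service_kernel.
    rewrite (proj2 (Nat.leb_gt (S m) (S i))) by lia; ring.
Qed.

(** * Stationary laws of the D/M/1 queue *)

Section DeterministicQueue.

Variables (lam mu s : R) (a : nat -> R).
Hypotheses (Hlam : 0 < lam) (Hmu : 0 < mu) (Hs : 0 < s < 1).
Hypothesis Hfix : s = exp (- ((1 - s) / (lam / mu))).
Hypothesis Ha : DM1_arrival_stationary lam mu a.

(** By [Hfix] the Poisson generating function at s equals s, so c s^m solves the same recursion as
    [a]. For c = [a 0] the difference is summable and vanishes at 0, hence everywhere; total mass 1
    then gives c = 1 - s. *)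
Lemma DM1_arrival_law (m : nat) : a m = (1 - s) * s ^ m.
Proof.
  destruct Ha as [Hpos [Hsum Hstat]].
  (* The mean number of potential services in one inter-arrival time, that is 1 / rho. *)
  set (x := mu * / lam).
  assert (Hx : 0 < x) by (apply Rmult_lt_0_compat; [|apply Rinv_0_lt_compat]; lra).
  assert (Hfx : exp (- (x * (1 - s))) = s).
  { rewrite Hfix at 2; f_equal; unfold x; field; lra. }
  set (c := a 0%nat); set (d := fun m => a m - c * s ^ m).
  assert (Hc : 0 <= c) by apply Hpos.
  assert (Hgeo := geom_series c s ltac:(lra)).
  assert (Hle : forall l, poisson x l <= 1).
  { intros l; apply (series_term_le (poisson x));
      [intros; apply poisson_nonneg; lra|apply poisson_total]. }
  assert (Hshift : forall m, ex_series (fun l => a (m + l)%nat)).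
  { intros k; apply ex_series_incr_n; now exists 1. }
  assert (Habs : ex_series (fun k => Rabs (d k))).
  { apply (ex_series_dominated _ (fun k => a k + c * s ^ k)).
    - intros k; rewrite Rabs_Rabsolu; unfold d.
      pose proof (Hpos k); assert (0 <= c * s ^ k)
        by (apply Rmult_le_pos; [exact Hc|apply pow_le; lra]).
      apply Rabs_le; lra.
    - eexists; exact (is_series_plus _ _ _ _ Hsum Hgeo). }
  assert (Hrec : forall k, is_series (fun l => poisson x l * d (k + l)%nat) (d (S k))).
  { intros k.
    assert (H1 : is_series (fun l => poisson x l * a (k + l)%nat) (a (S k))).
    { rewrite <- Hstat, DM1_after_S; fold x; apply Series_correct.
      apply (ex_series_dominated _ (fun l => a (k + l)%nat)); [|apply Hshift].
      intros l; pose proof (poisson_pos x l Hx); pose proof (Hpos (k + l)%nat).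
      specialize (Hle l); rewrite Rabs_pos_eq by (apply Rmult_le_pos; lra).
      apply Rle_trans with (1 * a (k + l)%nat); [|lra].
      now apply Rmult_le_compat_r. }
    assert (H2 : is_series (fun l => poisson x l * (c * s ^ (k + l))) (c * s ^ S k)).
    { pose proof (is_series_scal_R (c * s ^ k) _ _ (poisson_generating x s)) as H.
      rewrite Hfx in H; replace (c * s ^ S k) with (c * s ^ k * s) by (simpl; ring).
      revert H; apply is_series_ext_R; intros l; rewrite pow_add; ring. }
    pose proof (is_series_minus_R _ _ _ _ H1 H2) as H; revert H.
    apply is_series_ext_R; intros l.
    unfold d; ring. }
  assert (Hd : forall j, d j = 0).
  { apply (backward_recursion_zero (poisson x)); auto.
    - intros l; now apply poisson_pos.
    - apply poisson_total.
    - unfold d, c; simpl; ring.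
    - intros k; rewrite <- (is_series_unique _ _ (Hrec k)).
      assert (Hmul : forall l, Rabs (poisson x l * d (k + l)%nat)
        = poisson x l * Rabs (d (k + l)%nat)).
      { intros l; rewrite Rabs_mult, Rabs_pos_eq; [reflexivity|].
        apply poisson_nonneg; lra. }
      rewrite <- (Series_ext _ _ Hmul); apply Series_Rabs.
      apply (ex_series_dominated _ (fun l => Rabs (d (k + l)%nat)));
        [|now apply (ex_series_incr_n (fun l => Rabs (d l)))].
      intros l; rewrite Rabs_Rabsolu, Hmul; pose proof (Rabs_pos (d (k + l)%nat)).
      specialize (Hle l); nra. }
  assert (Hgeo' : is_series a (c / (1 - s))).
  { revert Hgeo; apply is_series_ext_R; intros k; specialize (Hd k); unfold d in Hd; lra. }
  pose proof (is_series_unique _ _ Hgeo') as E.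
  rewrite (is_series_unique _ _ Hsum) in E.
  assert (Hc1 : c = 1 - s).
  { transitivity (c / (1 - s) * (1 - s)); [field; lra|rewrite <- E; ring]. }
  specialize (Hd m); unfold d in Hd; rewrite <- Hc1; lra.
Qed.

(** Between arrivals the geometric shape persists on the busy states; only the probability of being
    busy decays, by the factor that the Poisson generating function takes at s. *)
Lemma DM1_after_law (t : R) (m : nat) : 0 <= t ->
  DM1_after mu a t m =
  match m with
  | O => 1 - exp (- (mu * (1 - s) * t))
  | S n => (1 - s) * s ^ n * exp (- (mu * (1 - s) * t))
  end.
Proof.
  intros Ht.
  assert (Hx : 0 <= mu * t) by (apply Rmult_le_pos; lra).
  replace (- (mu * (1 - s) * t)) with (- (mu * t * (1 - s))) by ring.
  destruct m as [|m].
  - destruct Ha as [_ [Hsum _]]; apply is_series_unique.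
    pose proof (is_series_minus_R _ _ _ _ Hsum
      (poisson_cumulative_generating (mu * t) s Hx ltac:(lra))) as H; revert H.
    apply is_series_ext_R; intros i.
    unfold service_kernel; rewrite DM1_arrival_law; ring.
  - rewrite DM1_after_S; apply is_series_unique.
    pose proof (is_series_scal_R ((1 - s) * s ^ m) _ _
      (poisson_generating (mu * t) s)) as H; revert H.
    apply is_series_ext_R; intros l; rewrite DM1_arrival_law, pow_add; ring.
Qed.

(** The fixed point equation makes the exponential equal to s at the upper end, so the integral is
    (1 - s) / (mu (1 - s)). *)
Lemma is_RInt_exp_interarrival :
  is_RInt (fun t => exp (- (mu * (1 - s) * t))) 0 (/ lam) (/ mu).
Proof.
  assert (Hk : 0 < mu * (1 - s)) by (apply Rmult_lt_0_compat; lra).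
  set (F := fun t => - exp (- (mu * (1 - s) * t)) / (mu * (1 - s))).
  replace (/ mu) with (F (/ lam) - F 0).
  - apply (is_RInt_derive F).
    + intros t _; unfold F; auto_derive; [exact I|field; lra].
    + intros t _; apply (ex_derive_continuous (V := R_NormedModule)).
      auto_derive; exact I.
  - unfold F; replace (- (mu * (1 - s) * 0)) with 0 by ring; rewrite exp_0.
    replace (- (mu * (1 - s) * / lam)) with (- ((1 - s) / (lam / mu)))
      by (field; lra).
    rewrite <- Hfix; field; lra.
Qed.

Lemma DM1_customers_law (m : nat) :
  DM1_customers lam mu a m = queue_law (lam / mu) s m.
Proof.
  assert (Hl : 0 < / lam) by (apply Rinv_0_lt_compat; lra).
  unfold DM1_customers.
  rewrite (RInt_ext _ (fun t => match m with
    | O => 1 - exp (- (mu * (1 - s) * t))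
    | S n => (1 - s) * s ^ n * exp (- (mu * (1 - s) * t))
    end)) by (intros t; rewrite Rmin_left by lra; intros H; apply DM1_after_law; lra).
  pose proof is_RInt_exp_interarrival as H; destruct m as [|m]; simpl queue_law.
  - erewrite is_RInt_unique;
      [|exact (is_RInt_minus _ _ _ _ _ _ (is_RInt_const 0 (/ lam) 1) H)].
    change (lam * ((/ lam - 0) * 1 - / mu) = 1 - lam / mu); field; lra.
  - erewrite is_RInt_unique; [|exact (is_RInt_scal _ _ _ ((1 - s) * s ^ m) _ H)].
    change (lam * ((1 - s) * s ^ m * / mu) = lam / mu * (1 - s) * s ^ m).
    field; lra.
Qed.

End DeterministicQueue.

(** * Stochastic order and convergence of the moments *)

Theorem corollary5p5 (lam mu : R)
    (hlam : 0 < lam) (hmu : 0 < mu) (hrho : lam / mu < 1)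
    (p : nat -> nat -> nat -> R)
    (hp : forall k : nat, (1 <= k)%nat -> EkM1_stationary lam mu k (p k))
    (a : nat -> R) (ha : DM1_arrival_stationary lam mu a) :
  (forall k : nat, (1 <= k)%nat ->
     st_le (DM1_customers lam mu a) (EkM1_customers (S k) (p (S k))) /\
     st_le (EkM1_customers (S k) (p (S k))) (EkM1_customers k (p k))) /\
  (exists (L W V : nat -> R) (LD WD VD : R),
     (forall k : nat, (1 <= k)%nat ->
        is_mean (EkM1_customers k (p k)) (L k) /\
        is_mean_sojourn mu (EkM1_at_arrival k (p k)) (W k) /\
        is_variance (EkM1_customers k (p k)) (V k)) /\
     is_mean (DM1_customers lam mu a) LD /\
     is_mean_sojourn mu a WD /\
     is_variance (DM1_customers lam mu a) VD /\
     decreases_to L LD /\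
     decreases_to W WD /\
     decreases_to V VD).
Proof.
  set (rho := lam / mu).
  assert (Hrho : 0 < rho < 1) by (split; [now apply Rdiv_lt_0_compat|exact hrho]).
  set (z := fun K => proj1_sig (phase_root_exists rho K Hrho)).
  assert (Hz : forall K, phase_root rho K (z K)) by (intros K; apply proj2_sig); clearbody z.
  destruct (phase_sigma_limit rho z (proj1 Hrho) Hz) as [s [Hlim [Hs1 Hfix]]].
  assert (Hs : 0 < s < 1) by (split; [rewrite Hfix; apply exp_pos|exact Hs1]).
  (* This is sigma_k for k >= 1, the roots [z] being indexed by K = k - 1. At k = 0 it takes the
     value 1, so the bounds below are stated for k >= 1. *)
  set (sg := fun k => z (k - 1)%nat ^ k).
  assert (Hsg : forall k, (1 <= k)%nat -> 0 < sg k < 1).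
  { intros [|K] HK; [lia|]; unfold sg; rewrite Nat.sub_succ, Nat.sub_0_r.
    exact (phase_sigma_bounds lam mu (z K) K (Hz K)). }
  assert (Hdecr : forall k, (1 <= k)%nat -> sg (S k) <= sg k).
  { intros [|K] HK; [lia|]; unfold sg; rewrite !Nat.sub_succ, !Nat.sub_0_r.
    now apply phase_sigma_decr with rho. }
  assert (Hsglim : is_lim_seq sg s).
  { apply is_lim_seq_incr_1; revert Hlim; apply is_lim_seq_ext.
    intros K; unfold sg; now rewrite Nat.sub_succ, Nat.sub_0_r. }
  assert (Hsge : forall k, (1 <= k)%nat -> s <= sg k).
  { intros [|K] HK; [lia|].
    apply (is_lim_seq_decr_compare (fun n => sg (S n)) s).
    - exact (proj1 (is_lim_seq_incr_1 sg s) Hsglim).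
    - intros n; apply Hdecr; lia. }
  assert (HEk : forall k, (1 <= k)%nat ->
    forall m, EkM1_customers k (p k) m = queue_law rho (sg k) m).
  { intros [|K] HK m; [lia|]; unfold sg; rewrite Nat.sub_succ, Nat.sub_0_r.
    exact (EkM1_customers_law lam mu (z K) K (p (S K)) hlam hmu (Hz K) (hp _ HK) m). }
  assert (Harr : forall k, (1 <= k)%nat ->
    forall m, EkM1_at_arrival k (p k) m = (1 - sg k) * sg k ^ m).
  { intros [|K] HK m; [lia|]; unfold sg; rewrite Nat.sub_succ, Nat.sub_0_r.
    exact (EkM1_at_arrival_law lam mu (z K) K (p (S K)) hlam hmu (Hz K) (hp _ HK) m). }
  pose proof (DM1_arrival_law lam mu s a hlam hmu Hs Hfix ha) as Ha.
  pose proof (DM1_customers_law lam mu s a hlam hmu Hs Hfix ha) as HD.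
  fold rho in HD.
  split.
  { intros k Hk; specialize (Hsg k Hk) as H0; specialize (Hsg (S k) ltac:(lia)) as H1.
    split.
    - apply (st_le_ext _ _ _ _ HD (HEk (S k) ltac:(lia))).
      apply queue_law_st_le; [exact Hrho|split; [lra|apply Hsge; lia]|lra].
    - apply (st_le_ext _ _ _ _ (HEk (S k) ltac:(lia)) (HEk k Hk)).
      apply queue_law_st_le; [exact Hrho|split; [lra|now apply Hdecr]|lra]. }
  assert (Hinv : forall k, (1 <= k)%nat -> / (1 - sg (S k)) <= / (1 - sg k)).
  { intros k Hk; pose proof (Hsg k Hk); pose proof (Hdecr k Hk).
    apply Rinv_le_contravar; lra. }
  assert (Hgap : is_lim_seq (fun k => 1 - sg k) (1 - s)).
  { apply is_lim_seq_minus'; [apply is_lim_seq_const|exact Hsglim]. }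
  (* The closed forms of the moments at sigma_k and at s; mean number and sojourn time are related
     by Little's law, L = lam W. *)
  exists (fun k => rho / (1 - sg k)), (fun k => / (mu * (1 - sg k))),
    (fun k => queue_variance rho (sg k)), (rho / (1 - s)), (/ (mu * (1 - s))),
    (queue_variance rho s).
  repeat split.
  - specialize (Hsg k H).
    apply (is_mean_ext (queue_law rho (sg k))); [intros; symmetry; now apply HEk|].
    apply queue_law_mean; lra.
  - specialize (Hsg k H); apply geometric_mean_sojourn; [exact hmu|lra|now apply Harr].
  - specialize (Hsg k H).
    apply (is_variance_ext (queue_law rho (sg k))); [intros; symmetry; now apply HEk|].
    apply queue_law_variance; lra.
  - apply (is_mean_ext (queue_law rho s)); [intros; symmetry; apply HD|].
    apply queue_law_mean; lra.
  - apply geometric_mean_sojourn; [exact hmu|lra|exact Ha].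
  - apply (is_variance_ext (queue_law rho s)); [intros; symmetry; apply HD|].
    apply queue_law_variance; lra.
  - intros k Hk; apply Rmult_le_compat_l; [lra|now apply Hinv].
  - apply is_lim_seq_div'; [apply is_lim_seq_const|exact Hgap|lra].
  - intros k Hk; rewrite !Rinv_mult; apply Rmult_le_compat_l; [|now apply Hinv].
    now apply Rlt_le, Rinv_0_lt_compat.
  - apply is_lim_seq_ext with (fun k => 1 / (mu * (1 - sg k)));
      [intros k; apply Rmult_1_l|].
    rewrite <- (Rmult_1_l (/ (mu * (1 - s)))).
    apply is_lim_seq_div'; [apply is_lim_seq_const| |].
    + apply is_lim_seq_mult'; [apply is_lim_seq_const|exact Hgap].
    + apply Rmult_integral_contrapositive_currified; lra.
  - intros k Hk; pose proof (Hsg k Hk); pose proof (Hsg (S k) ltac:(lia)).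
    specialize (Hdecr k Hk); unfold queue_variance, Rdiv; rewrite <- !pow_inv.
    apply Rmult_le_compat.
    + apply Rmult_le_pos; lra.
    + apply pow_le, Rlt_le, Rinv_0_lt_compat; lra.
    + apply Rmult_le_compat_l; lra.
    + apply pow_incr; split; [apply Rlt_le, Rinv_0_lt_compat; lra|now apply Hinv].
  - unfold queue_variance; apply is_lim_seq_div'.
    + apply is_lim_seq_mult'; [apply is_lim_seq_const|].
      apply is_lim_seq_minus'; [|apply is_lim_seq_const].
      apply is_lim_seq_plus'; [apply is_lim_seq_const|exact Hsglim].
    + apply is_lim_seq_mult'; [exact Hgap|].
      apply is_lim_seq_mult'; [exact Hgap|apply is_lim_seq_const].
    + apply pow_nonzero; lra.
Qed.
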